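(* Let $\Lambda$ be a compact minimal set of a $C^0$ non-wandering flow on a generalized Peano continuum $M$. Then, either (1) $\Lambda\in\mathrm{cl}_H\,\mathcal{U}$, or (2) $\Lambda=M$, i.e. $M$ is compact and the flow is minimal, or (3) there are arbitrarily small compact, connected, invariant neighbourhoods $U$ of $\Lambda$ in $M$ such that: (a) $U$ is the union of $\mathfrak{c}=|\mathbb{R}|$ hyper-stable compact minimal sets, i.e. $U=H\mathcal{S}(U)^*$; (b) $H\mathcal{S}(U)$ is a (non-degenerate) Peano continuum (in the Hausdorff metric).
   Context: A generalized Peano continuum is a locally compact, connected and locally connected metric space; a Peano continuum is a compact one; non-degenerate means having more than one point. A $C^0$ flow on $M$ is a continuous action of $(\mathbb{R},+)$ on $M$, written $(t,x)\mapsto x^t$. It is non-wandering if every point of $M$ is non-wandering (for every neighbourhood $V$ of $x$ and every $T>0$ there is $t\ge T$ with $V^t\cap V\ne\emptyset$). A minimal set is a nonempty closed invariant set containing no smaller nonempty closed invariant set; the flow is minimal if $M$ is a minimal set. $\mathrm{CMin}$ is the set of all compact minimal sets of the flow, endowed with the Hausdorff metric $d_H$; $\mathrm{cl}_H$ is closure in $[\mathrm{CMin},d_H]$. A neighbourhood of a set $Y\subset M$ is a set whose interior contains $Y$; ''arbitrarily small neighbourhoods $U$ of $\Lambda$ with property P'' means that every neighbourhood of $\Lambda$ contains a neighbourhood $U$ of $\Lambda$ with property P. A nonempty compact invariant set $K$ is (Lyapunov) stable if every neighbourhood of $K$ contains a positively invariant neighbourhood of $K$; otherwise unstable. $\mathcal{U}$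 is the set of unstable compact minimal sets. $\Lambda\in\mathrm{CMin}$ is hyper-stable if some neighbourhood of $\Lambda$ in $M$ intersects no $\Gamma\in\mathcal{U}$; $H\mathcal{S}(U)$ is the set of hyper-stable compact minimal sets contained in $U$. For $C\subset\mathrm{CMin}$, $C^*:=\bigcup_{\Lambda\in C}\Lambda\subset M$. *)

(* Defs.v *)
From HB Require Import structures.
From mathcomp Require Import all_boot all_order all_algebra.
From mathcomp Require Import all_classical all_reals all_analysis.

Set Implicit Arguments.
Unset Strict Implicit.
Unset Printing Implicit Defensive.

Import Order.TTheory GRing.Theory Num.Theory.
Import numFieldNormedType.Exports.

Local Open Scope classical_set_scope.
Local Open Scope ring_scope.

Record compacts (R : realType) (M : metricType R) := Compacts {
  compacts_set :> set M;
  compacts_neq0 : compacts_set !=set0;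
  compacts_compact : compact compacts_set }.

HB.instance Definition _ (R : realType) (M : metricType R) :=
  gen_eqMixin (compacts M).
HB.instance Definition _ (R : realType) (M : metricType R) :=
  gen_choiceMixin (compacts M).

Section hausdorff_metric.
Context {R : realType} {M : metricType R}.
Implicit Types (x y : M) (A B C : set M).

Definition dist_to_set x B : R := inf [set mdist x y | y in B].

Definition hausdorff_excess A B : R := sup [set dist_to_set x B | x in A].

Definition hausdorff_dist A B : R :=
  Num.max (hausdorff_excess A B) (hausdorff_excess B A).

Lemma compacts_inj (K L : compacts M) : K = L :> set M -> K = L.
Proof.
case: K L => [A A0 cA] [B B0 cB] /= AB; subst B.
by congr Compacts; exact: Prop_irrelevance.
Qed.

Lemma dist_to_set_le x y B : B y -> dist_to_set x B <= mdist x y.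
Proof.
move=> By; apply: ge_inf; last by exists y.
by exists 0 => _ [z _ <-]; exact: mdist_ge0.
Qed.

Lemma dist_to_set_ge x B (e : R) : B !=set0 ->
  (forall y, B y -> e <= mdist x y) -> e <= dist_to_set x B.
Proof.
move=> [y By] eB; apply: lb_le_inf; first by exists (mdist x y), y.
by move=> _ [z Bz <-]; exact: eB.
Qed.

Lemma dist_to_set_triangle x y B : B !=set0 ->
  dist_to_set x B <= mdist x y + dist_to_set y B.
Proof.
move=> B0; rewrite addrC -lerBlDr; apply: dist_to_set_ge => // z Bz.
rewrite lerBlDr addrC.
exact: le_trans (dist_to_set_le _ Bz) (metric_triangle _ _ _).
Qed.

Lemma dist_to_set_has_sup A B : A !=set0 -> compact A -> B !=set0 ->
  has_sup [set dist_to_set x B | x in A].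
Proof.
move=> [a Aa] /compact_near_coveringP cA [b Bb].
split; first by exists (dist_to_set a B), a.
have : \forall r \near +oo, A `<=` (fun x => mdist b x < r).
  apply: cA => x Ax.
  near=> z r => /=.
  apply: (@lt_trans _ _ (mdist b x + 1)); last first.
    by near: r; apply: nbhs_pinfty_gt; exact: num_real.
  apply: (le_lt_trans (metric_triangle _ x _)); rewrite ltrD2l.
  suff : ball x 1 z by rewrite ballEmdist.
  by near: z; exact: nbhsx_ballx.
case=> r [_ rA].
exists (r + 1) => _ [x Ax <-].
apply: (le_trans (dist_to_set_le x Bb)).
by rewrite metric_sym ltW// (rA (r + 1)) // ltrDl.
Unshelve. all: by end_near. Qed.

Lemma dist_to_set_le_excess A B x : compact A -> B !=set0 -> A x ->
  dist_to_set x B <= hausdorff_excess A B.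
Proof.
move=> cA B0 Ax; apply: ub_le_sup; last by exists x.
by have [] := @dist_to_set_has_sup A B (ex_intro _ x Ax) cA B0.
Qed.

Lemma hausdorff_excess_le A B (e : R) : A !=set0 ->
  (forall x, A x -> dist_to_set x B <= e) -> hausdorff_excess A B <= e.
Proof.
move=> [a Aa] Ae; apply: ge_sup; first by exists (dist_to_set a B), a.
by move=> _ [x Ax <-]; exact: Ae.
Qed.

Lemma hausdorff_excess_triangle (B A C : compacts M) :
  hausdorff_excess A C <= hausdorff_excess A B + hausdorff_excess B C.
Proof.
move: A B C => [A A0 cA] [B B0 cB] [C C0 cC] /=.
apply: hausdorff_excess_le => // x Ax.
apply: (@le_trans _ _ (dist_to_set x B + hausdorff_excess B C)); last first.
  by rewrite lerD2r dist_to_set_le_excess.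
rewrite -lerBlDr; apply: dist_to_set_ge => // y By; rewrite lerBlDr.
apply: (le_trans (dist_to_set_triangle x y C0)).
by rewrite lerD2l dist_to_set_le_excess.
Qed.

Lemma hausdorff_excess_subset (A B : compacts M) :
  hausdorff_excess A B <= 0 -> (A : set M) `<=` B.
Proof.
move: A B => [A A0 cA] [B B0 cB] /= AB0 x Ax.
have /closure_id -> := compact_closed (@metric_hausdorff _ M) cB.
move=> V /nbhs_ballP[e /= e0 eV].
have : dist_to_set x B < e.
  by rewrite (le_lt_trans _ e0)// (le_trans _ AB0)// dist_to_set_le_excess.
have [b Bb] := B0.
move/inf_lt => [].
  by exists (mdist x b), b.
by move=> _ [y By <-] xye; exists y; split => //; apply: eV; rewrite ballEmdist.
Qed.

Lemma hausdorff_excessxx (A : compacts M) : hausdorff_excess A A = 0.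
Proof.
case: A => [A [a Aa] cA] /=.
have d0 x : A x -> dist_to_set x A = 0.
  move=> Ax; apply/eqP; rewrite eq_le -{1}(mdistxx x) dist_to_set_le//=.
  by apply: dist_to_set_ge => [|y _]; [exists a|exact: mdist_ge0].
apply/eqP; rewrite eq_le hausdorff_excess_le//=; last 2 first.
- by exists a.
- by move=> x Ax; rewrite d0.
by rewrite -(d0 a Aa) dist_to_set_le_excess//; exists a.
Qed.

Lemma hausdorff_distxx (A : compacts M) : hausdorff_dist A A = 0.
Proof. by rewrite /hausdorff_dist maxxx hausdorff_excessxx. Qed.

Lemma hausdorff_dist_eq0 (A B : compacts M) : hausdorff_dist A B = 0 -> A = B.
Proof.
move=> AB0; apply/compacts_inj/seteqP.
by split; apply: hausdorff_excess_subset; rewrite -AB0 le_max lexx ?orbT.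
Qed.

Lemma hausdorff_dist_sym (A B : compacts M) :
  hausdorff_dist A B = hausdorff_dist B A.
Proof. exact: maxC. Qed.

Lemma hausdorff_dist_triangle (B A C : compacts M) :
  hausdorff_dist A C <= hausdorff_dist A B + hausdorff_dist B C.
Proof.
rewrite ge_max; apply/andP; split.
  apply: (le_trans (hausdorff_excess_triangle B A C)).
  by apply: lerD; rewrite le_max lexx.
apply: (le_trans (hausdorff_excess_triangle B C A)).
by rewrite addrC; apply: lerD; rewrite le_max lexx orbT.
Qed.

HB.instance Definition _ := @isMetric.Build R (compacts M) hausdorff_dist
  hausdorff_distxx hausdorff_dist_eq0 hausdorff_dist_sym
  hausdorff_dist_triangle.

End hausdorff_metric.

Definition locally_connected (T : topologicalType) (A : set T) : Prop :=
  forall x V, A x -> nbhs x V ->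
    exists W, [/\ open W, W x, A `&` W `<=` V & connected (A `&` W)].

(* [locally_compact] is relative to the ambient space, hence meaningful as an
   intrinsic property only on the full set. *)
Definition generalized_peano_continuum (R : realType) (M : metricType R) : Prop :=
  [/\ locally_compact [set: M], connected [set: M] &
      locally_connected [set: M]].

Definition peano_continuum (R : realType) (T : metricType R) (A : set T) : Prop :=
  [/\ compact A, connected A & locally_connected A].

Definition non_degenerate (T : Type) (A : set T) : Prop :=
  exists x y, [/\ A x, A y & x <> y].

(* A flow is given by its time-t maps: [phi t x] is $x^t$. *)
Definition C0_flow (R : realType) (M : metricType R) (phi : R -> M -> M) : Prop :=
  [/\ continuous (fun p : R * M => phi p.1 p.2),
      (forall x, phi 0 x = x) &
      (forall s t x, phi (s + t) x = phi s (phi t x))].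

Section flow_notions.
Context {R : realType} {M : metricType R} (phi : R -> M -> M).
Implicit Types (A K U V W : set M) (L G : compacts M) (C : set (compacts M)).

Definition non_wandering : Prop :=
  forall (x : M) V (T : R), nbhs x V -> 0 < T ->
    exists2 t, T <= t & (phi t @` V) `&` V !=set0.

Definition flow_invariant A : Prop := forall t, phi t @` A `<=` A.

Definition positively_invariant A : Prop :=
  forall t, 0 <= t -> phi t @` A `<=` A.

Definition minimal_set A : Prop :=
  [/\ A !=set0, closed A, flow_invariant A &
      forall B, B !=set0 -> closed B -> flow_invariant B -> B `<=` A -> B = A].

Definition minimal_flow : Prop := minimal_set [set: M].

Definition CMin : set (compacts M) := [set L | minimal_set L].

Definition closure_CMin C : set (compacts M) := CMin `&` closure C.

Definition lyapunov_stable K : Prop :=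
  forall V, set_nbhs K V ->
    exists W, [/\ set_nbhs K W, positively_invariant W & W `<=` V].

Definition unstable_CMin : set (compacts M) :=
  [set L | CMin L /\ ~ lyapunov_stable L].

Definition hyper_stable L : Prop :=
  CMin L /\ exists2 V, set_nbhs (L : set M) V &
    forall G, unstable_CMin G -> V `&` G = set0.

Definition HS U : set (compacts M) :=
  [set L | hyper_stable L /\ (L : set M) `<=` U].

Definition star C : set M := \bigcup_(L in C) (L : set M).

End flow_notions.

(* Main.v *)
Require Import Defs.
From HB Require Import structures.
From mathcomp Require Import all_boot all_order all_algebra.
From mathcomp Require Import all_classical all_reals all_analysis.
From mathcomp Require Import finmap lra.

Set Implicit Arguments.
Unset Strict Implicit.
Unset Printing Implicit Defensive.

Import Order.TTheory GRing.Theory Num.Theory.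
Import numFieldNormedType.Exports.

Local Open Scope classical_set_scope.
Local Open Scope card_scope.
Local Open Scope ring_scope.

(** Why the theorem holds.

    Recurrence turns one-sided stability into two-sided stability.  If [W] is
    closed and positively invariant and a point [y] outside [W] flows at some
    time into the interior of [W], then a whole neighbourhood of [y] enters
    [W] and never leaves it, so [y] is wandering.  In a non-wandering flow the
    complete orbits of interior points of [W] therefore stay in [W], and a
    stable compact set has arbitrarily small compact invariant neighbourhoods
    ([stable_invariant_nbhs]).

    Two consequences.  A compact minimal set [G] meeting such a neighbourhood
    [K] of a stable minimal set [L] lies inside [K]; being invariant and close
    to [L], it passes near every point of [L], hence is close to [L] for the
    Hausdorff metric ([stable_CMin_nbhs]).  So if [Lambda] is not in the
    closure of the unstable minimal sets, an open set [B] around [Lambda]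
    meets no unstable minimal set at all ([hyper_stable_nbhs]).  Secondly, an
    orbit whose closure contains a stable minimal set enters every invariant
    neighbourhood of it, hence lies in it ([orbit_closure_stable]).

    Fix a compact invariant neighbourhood [W] of [Lambda] inside [B].  Every
    orbit closure in [W] contains a minimal set (Zorn), which is stable, so
    [W] is partitioned into stable compact minimal sets, and the map [CMin_at]
    sending a point to its class is continuous for the Hausdorff metric.

    The classes met by [W] need not form a locally connected set, since the
    frontier of [W] is arbitrary.  Instead, choose a locally connected
    continuum [P] inside [W] that is a neighbourhood of one point of [Lambda]
    ([peano_nbhs]) and let [U] be the union of the classes that meet [P].
    Then [HS U] is the image of [P] under [CMin_at].  Continuous images of
    compact locally connected sets are locally connected, so [HS U] is a Peano
    continuum; both this fact and the construction of [P] go through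
    Sierpinski's property S, finite covers by arbitrarily small connected
    pieces.  [U] is a neighbourhood of [Lambda] because every orbit in
    [Lambda] is dense in it, hence visits the interior of [P]; it is connected
    because each class meets the connected set [P].

    If [HS U] were reduced to [Lambda], then [Lambda] would be open and closed
    in [M], hence equal to [M].  Otherwise distances from a point of the
    connected set [HS U] fill an interval, which gives at least continuum many
    elements; property S gives countably many sets that separate its points,
    which gives at most that many. *)

(** * Property S and local connectedness *)
Section property_S.
Context {R : realType}.

Definition diam_le (T : metricType R) (d : R) (A : set T) : Prop :=
  forall x y, A x -> A y -> mdist x y <= d.

(** Sierpinski's property S.  For compact sets it amounts to local
    connectedness, but it passes to closures and to continuous images at
    once. *)
Definition property_S (T : metricType R) (A : set T) : Prop :=
  forall d, 0 < d -> exists F : set (set T),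
    [/\ finite_set F, forall E, F E -> connected E /\ diam_le d E &
        A = \bigcup_(E in F) E].

Lemma nbhs_mdistP (T : metricType R) (x : T) (A : set T) :
  nbhs x A <-> exists2 e, 0 < e & forall y, mdist x y < e -> A y.
Proof.
split=> [/nbhs_ballP[e /= e0 eA]|[e e0 eA]].
  by exists e => // y xy; apply: eA; rewrite ballEmdist.
by apply/nbhs_ballP; exists e => // y; rewrite ballEmdist; exact: eA.
Qed.

Lemma nbhs_mdist_lt (T : metricType R) (x : T) (e : R) : 0 < e ->
  \forall y \near x, mdist x y < e.
Proof. by move=> e0; apply/nbhs_mdistP; exists e. Qed.

Lemma within_continuous_mdistP (T : topologicalType) (U : metricType R)
    (f : T -> U) (A : set T) :
  {within A, continuous f} <->
  forall x, A x -> forall e, 0 < e ->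
    \forall y \near x, A y -> mdist (f x) (f y) < e.
Proof.
split=> [/subspace_continuousP fA x Ax e e0|fA].
  exact: (fA x Ax _ (nbhs_mdist_lt (f x) e0)).
apply/subspace_continuousP => x Ax V /nbhs_mdistP[e e0 eV].
have : \forall y \near x, A y -> V (f y).
  by apply: filterS (fA x Ax e e0) => y fxy Ay; apply: eV; exact: fxy.
by [].
Qed.

Lemma diam_le_closure (T : metricType R) (d : R) (A : set T) :
  diam_le d A -> diam_le d (closure A).
Proof.
move=> dA x y cx cy; apply/ler_addgt0Pr => e e0.
have e20 : 0 < e / 2 by rewrite divr_gt0.
have [x' [Ax' xx']] := cx _ (nbhs_mdist_lt x e20).
have [y' [Ay' yy']] := cy _ (nbhs_mdist_lt y e20).
rewrite (le_trans (metric_triangle _ x' _))// (splitr e) addrCA.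
rewrite lerD ?(ltW xx')//.
rewrite (le_trans (metric_triangle _ y' _))// lerD ?dA//.
by rewrite metric_sym ltW.
Qed.

Lemma closed_mdist_le (T : metricType R) (p : T) (r : R) :
  closed [set y | mdist p y <= r].
Proof.
move=> y cy /=; apply/ler_addgt0Pr => e e0.
have [z [/= pz yz]] := cy _ (nbhs_mdist_lt y e0).
rewrite (le_trans (metric_triangle _ z _))// lerD//.
by rewrite metric_sym ltW.
Qed.

Lemma property_S_closure (T : metricType R) (A : set T) :
  property_S A -> property_S (closure A).
Proof.
move=> SA d d0; have [F [finF FE ->]] := SA d d0.
exists (closure @` F); split; first exact: finite_image.
  move=> _ [E /FE[cE dE] <-]; split; first exact: connected_closure.
  exact: diam_le_closure.
rewrite bigcup_image; apply/seteqP; split.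
  have : closed (\bigcup_(E in F) closure E).
    by apply: closed_bigcup => // E _; exact: closed_closure.
  rewrite closure_id => ->; apply: closureS => x [E FE' Ex]; exists E => //.
  exact: subset_closure.
by apply: bigcup_sub => E FE'; apply: closureS => x Ex; exists E.
Qed.

Lemma within_compact_uniform (T U : metricType R) (A : set T) (f : T -> U) :
  compact A -> {within A, continuous f} -> forall e, 0 < e ->
  exists2 d, 0 < d & forall x y, A x -> A y -> mdist x y <= d ->
    mdist (f x) (f y) <= e.
Proof.
move=> /compact_near_coveringP cA /within_continuous_mdistP fA e e0.
have e20 : 0 < e / 2 by rewrite divr_gt0.
have : \forall d \near 0^'+, A `<=` (fun x => A x -> forall y, A y ->
    mdist x y <= d -> mdist (f x) (f y) <= e).
  apply: cA => x Ax.
  have [r r0 rf] := (iffLR (nbhs_mdistP _ _)) (fA x Ax _ e20).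
  have r20 : 0 < r / 2 by rewrite divr_gt0.
  near=> x' d => Ax' y Ay xy.
  have xx' : mdist x x' < r / 2 by near: x'; exact: nbhs_mdist_lt.
  have dr : d < r / 2 by near: d; exact: nbhs_right_lt.
  rewrite (le_trans (metric_triangle _ (f x) _))// (splitr e) lerD//.
    rewrite metric_sym ltW// rf// (lt_le_trans xx')//.
    by rewrite ler_pdivrMr// ler_pMr// ler1n.
  rewrite ltW// rf// (le_lt_trans (metric_triangle _ x' _))// (splitr r).
  by rewrite ltrD// (le_lt_trans xy).
move=> near_d.
have : \forall d \near 0^'+, 0 < d /\ A `<=` (fun x => A x -> forall y, A y ->
    mdist x y <= d -> mdist (f x) (f y) <= e).
  by near=> d; split; near: d => //; exact: nbhs_right_gt.
move=> /filter_ex[d [d0 dA]]; exists d => // x y Ax Ay xy.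
exact: (dA x Ax Ax y Ay xy).
Unshelve. all: by end_near. Qed.

Lemma property_S_image (T U : metricType R) (A : set T) (f : T -> U) :
  compact A -> {within A, continuous f} -> property_S A ->
  property_S (f @` A).
Proof.
move=> cA fA SA e e0.
have [d d0 df] := within_compact_uniform cA fA e0.
have [F [finF FE AE]] := SA d d0.
have FA E : F E -> E `<=` A by move=> FE'; rewrite AE; exact: bigcup_sup.
exists (image^~ f @` F); split; first exact: finite_image.
  move=> _ [E FE' <-]; have [cE dE] := FE E FE'; split.
    apply: (connected_continuous_connected cE).
    exact: continuous_subspaceW (FA E FE') fA.
  move=> _ _ [x Ex <-] [y Ey <-]; apply: df; [exact: FA Ex|exact: FA Ey|].
  exact: dE.
by rewrite bigcup_image [in LHS]AE image_bigcup.
Qed.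

(** In a cover of [A] by finitely many small compact connected pieces, the
    pieces that avoid [x] have a closed union, so the union of those containing
    [x] is a small connected neighbourhood of [x] in [A].  Once this is known
    at every point, components of relatively open sets are relatively
    open. *)
Lemma compact_property_S_locally_connected (T : metricType R) (A : set T) :
  compact A -> property_S A -> locally_connected A.
Proof.
move=> cA SA.
have clA : closed A := compact_closed (@metric_hausdorff _ T) cA.
have cik x (V : set T) : A x -> nbhs x V -> exists C : set T,
    [/\ C x, connected C, C `<=` A `&` V & \forall y \near x, A y -> C y].
  move=> Ax /nbhs_mdistP[e e0 eV].
  have e20 : 0 < e / 2 by rewrite divr_gt0.
  have [F [finF FE AE]] := SA _ e20.
  pose G := [set closure E | E in F].
  have finG : finite_set G by exact: finite_image.
  have GE E : G E -> [/\ connected E, diam_le (e / 2) E, closed E & E `<=` A].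
    move=> [D FD <-]; have [cD dD] := FE D FD; split.
    - exact: connected_closure.
    - exact: diam_le_closure.
    - exact: closed_closure.
    - rewrite [X in _ `<=` X](iffLR (closure_id A) clA).
      by apply: closureS; rewrite AE; exact: bigcup_sup.
  exists (\bigcup_(E in [set E | G E /\ E x]) E); split.
  - move: (Ax); rewrite AE => -[E FE' Ex].
    exists (closure E); last exact: subset_closure.
    by split; [exists E|exact: subset_closure].
  - apply: bigcup_connected; first by exists x => E [].
    by move=> E [/GE[]].
  - move=> y [E [/GE[cE dE _ EA] Ex] Ey]; split; first exact: EA.
    apply: eV; apply: (le_lt_trans (dE _ _ Ex Ey)).
    by rewrite ltr_pdivrMr// ltr_pMr// ltr1n.
  - have : closed (\bigcup_(E in [set E | G E /\ ~ E x]) E).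
      apply: closed_bigcup => [|E [/GE[]]//].
      by apply: sub_finite_set finG => E [].
    move=> /closed_openC oB.
    have : (~` \bigcup_(E in [set E | G E /\ ~ E x]) E) x by move=> [E []].
    move=> /(conj oB)/open_nbhs_nbhs; apply: filterS => y By.
    rewrite AE => -[E FE' Ey]; exists (closure E); last exact: subset_closure.
    split; first by exists E.
    apply: contrapT => nEx; apply: By; exists (closure E).
      by split => //; exists E.
    exact: subset_closure.
move=> x V Ax xV.
pose C := connected_component (A `&` V°) x.
have Cx : C x.
  exact: connected_component_refl.
have CA : C `<=` A `&` V° by exact: connected_component_sub.
have Cnear y : C y -> \forall z \near y, A z -> C z.
  move=> Cy; have [Ay Vy] := CA _ Cy.
  have [|D [Dy cD DA nD]] := cik y V° Ay; first exact: nbhs_interior.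
  apply: filterS nD => z nD /nD Dz.
  apply: (connected_component_trans (y := y)) => //.
  by exists D.
(* [C] is open relatively to [A], so [~` A `|` C] is a neighbourhood of each
   point of [C], and its interior is an ambient open set with trace [C]. *)
exists (~` A `|` C)°; split.
- exact: open_interior.
- apply: filterS (Cnear x Cx) => z nC.
  by have [/nC|] := pselect (A z); [right|left].
- by move=> y [Ay /interior_subset[//|/CA[_ /interior_subset]]].
- suff -> : A `&` (~` A `|` C)° = C by exact: component_connected.
  apply/seteqP; split=> [y [Ay /interior_subset[]//]|y Cy].
  split; first by have [] := CA _ Cy.
  apply: filterS (Cnear y Cy) => z nC.
  by have [/nC|] := pselect (A z); [right|left].
Qed.

End property_S.

(** * Peano continua as neighbourhoods *)
Lemma compact_finite_subcover (T : topologicalType) (A : set T)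
    (D : set (set T)) :
  compact A -> (forall W, D W -> open W) -> A `<=` \bigcup_(W in D) W ->
  exists F, [/\ finite_set F, F `<=` D & A `<=` \bigcup_(W in F) W].
Proof.
have [-> _ _ _|/set0P[p _]] := eqVneq A set0.
  by exists set0; split => // x.
pose pT : ptopologicalType :=
  HB.pack_for ptopologicalType T (isPointed.Build T p).
have := @compact_cover pT => /(congr1 (@^~ A)) /= AE cA oD AD.
have : @cover_compact pT A by rewrite -AE; exact: cA.
move=> /(_ _ D id oD AD)[F FD AF]; exists [set` F]; split => //.
by move=> W /FD/set_mem.
Qed.

Lemma locally_compact_nbhs (T : topologicalType) (x : T) :
  locally_compact [set: T] -> exists K, [/\ nbhs x K, compact K & closed K].
Proof.
move=> /(_ x I)[K xK [cK clK]]; exists K; split => //.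
have {}xK : \forall y \near x, [set: T] y -> K y by exact: xK.
by apply: filterS xK => y; exact.
Qed.
Section peano_neighbourhoods.
Context {R : realType} {M : metricType R}.
Variables (p : M) (r : R).
Hypothesis r_gt0 : 0 < r.

Definition link_size n : R := r / 2 ^+ n.

(** [chain_hull n] consists of the points joined to [p] by a chain of [n]
    connected sets, the [m]-th of which has diameter at most [r / 2 ^ m].  The
    links shrink geometrically, so that all that is added after stage [n]
    stays within [2 * link_size n] of stage [n]. *)
Fixpoint chain_hull n : set M :=
  if n is m.+1 then
    [set y | exists C, [/\ connected C, diam_le (link_size m) C,
      C `&` chain_hull m !=set0 & C y]]
  else [set p].

Lemma link_size_gt0 n : 0 < link_size n.
Proof. by rewrite divr_gt0// exprn_gt0. Qed.

Lemma link_sizeS n : link_size n.+1 = link_size n / 2.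
Proof. by rewrite /link_size exprSr invfM mulrA. Qed.

Lemma link_size_small d : 0 < d -> exists n, link_size n < d.
Proof.
move=> d0; have half_lt1 : `|2^-1 : R| < 1.
  by rewrite ger0_norm// invf_lt1// ltr1n.
have := cvg_geometric r half_lt1.
move=> /cvgr0Pnorm_lt /(_ d d0) [n _ /(_ n (leqnn n))] /= rd.
exists n; apply: le_lt_trans rd.
by rewrite exprVn ler_norm.
Qed.

Lemma diam_le1 (d : R) (x : M) : 0 <= d -> diam_le d [set x].
Proof. by move=> d0 _ _ -> ->; rewrite mdistxx. Qed.

Lemma chain_hullS n : chain_hull n `<=` chain_hull n.+1.
Proof.
move=> y ny; exists [set y]; split=> //; last by exists y.
- exact: connected1.
- exact/diam_le1/ltW/link_size_gt0.
Qed.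

Lemma chain_hull_sub m n : (m <= n)%N -> chain_hull m `<=` chain_hull n.
Proof.
move/subnKC <-; elim: (n - m)%N => [|k IH]; first by rewrite addn0.
by rewrite addnS; exact: subset_trans IH (@chain_hullS _).
Qed.

Lemma chain_hull_base n : chain_hull n p.
Proof. exact: (chain_hull_sub (leq0n n)). Qed.

Lemma chain_hull_connected n : connected (chain_hull n).
Proof.
elim: n => [|n IH]; first exact: connected1.
pose D := [set C | [/\ connected C, diam_le (link_size n) C
  & C `&` chain_hull n !=set0]].
have -> : chain_hull n.+1 = \bigcup_(C in D) (chain_hull n `|` C).
  apply/seteqP; split => [y [C [cC dC mC Cy]]|y [C [cC dC mC] [|]]].
  - by exists C => //; right.
  - exact: chain_hullS.
  - by move=> Cy; exists C.
apply: bigcup_connected.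
  by exists p => C _; left; exact: chain_hull_base.
move=> C [cC _ mC]; apply: connectedU => //.
by rewrite setIC.
Qed.

(** The last links of a chain, from the [k]-th on, form a connected set that
    joins [y] to [chain_hull k]; the bound is the sum of a geometric
    series. *)
Lemma chain_hull_tail k j y : chain_hull (k + j) y ->
  exists C z, [/\ connected C, C `<=` chain_hull (k + j), C y,
    C z /\ chain_hull k z &
    forall x, C x -> mdist z x <= 2 * link_size k - 2 * link_size (k + j)].
Proof.
elim: j y => [|j IH] y.
  rewrite addn0 => ky; exists [set y], y; split => //.
  - exact: connected1.
  - by move=> _ ->.
  - by move=> _ ->; rewrite mdistxx subrr.
rewrite addnS => -[D [cD dD [y' [Dy' /IH[C [z [cC Ck Cy' [Cz kz] zC]]]]] Dy]].
exists (C `|` D), z; split => //.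
- by apply: connectedU => //; exists y'.
- move=> x [/Ck|Dx]; first exact: chain_hullS.
  by exists D; split => //; exists y'; split => //; exact: Ck.
- by right.
- by split => //; left.
- move=> x Cx; rewrite link_sizeS.
  have h0 := link_size_gt0 (k + j).
  case: Cx => [/zC|Dx]; first lra.
  have := zC _ Cy'; have := dD _ _ Dy' Dx; have := metric_triangle z y' x.
  lra.
Qed.

Definition chain_limit : set M := \bigcup_n chain_hull n.

Lemma chain_limit_connected : connected chain_limit.
Proof.
apply: bigcup_connected; first by exists p => n _; exact: chain_hull_base.
by move=> n _; exact: chain_hull_connected.
Qed.

Lemma chain_limit_bounded y : chain_limit y -> mdist p y <= 2 * r.
Proof.
move=> [n _ /(@chain_hull_tail 0)[C [_ [_ _ Cy [_ ->]]]]] /(_ _ Cy).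
have := link_size_gt0 n; rewrite add0n /link_size expr0; lra.
Qed.

Lemma small_connected_nbhs (x : M) (d : R) :
  locally_connected [set: M] -> 0 < d ->
  exists W, [/\ open W, W x, connected W & diam_le d W].
Proof.
move=> lcM d0; have d20 : 0 < d / 2 by rewrite divr_gt0.
have [W [oW Wx Wd cW]] := lcM x _ I (nbhs_mdist_lt x d20).
rewrite setTI in Wd cW; exists W; split => // y z Wy Wz.
rewrite (le_trans (metric_triangle _ x _))// (splitr d) lerD ?(ltW (Wd _ Wz))//.
by rewrite metric_sym (ltW (Wd _ Wy)).
Qed.

Lemma chain_limit_nbhs : locally_connected [set: M] -> nbhs p chain_limit.
Proof.
move=> lcM.
have [W [oW Wp cW dW]] := small_connected_nbhs p lcM (link_size_gt0 0).
apply: (@filterS _ _ _ W); last exact: open_nbhs_nbhs.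
by move=> y Wy; exists 1%N => //; exists W; split => //; exists p.
Qed.

(** Given [d], choose [k] with [link_size k] small and cover the compact set
    [K] by finitely many connected open sets of that size.  Those that meet
    [chain_hull k] lie in [chain_hull k.+1]; attaching to each of them all the
    short connected tails that start in it covers the whole limit, because a
    longer chain is such a tail started from [chain_hull k]. *)
Lemma chain_limit_property_S (K : set M) : locally_connected [set: M] ->
  compact K -> chain_limit `<=` K -> property_S chain_limit.
Proof.
move=> lcM cK SK d d0.
(* A piece [blob E] below is [E], of diameter [h], enlarged by [2 * h] in all
   directions, so its diameter is at most [5 * h]. *)
have [k kd] : exists k, link_size k < d / 5.
  by apply: link_size_small; rewrite divr_gt0.
pose h := link_size k; have h0 : 0 < h := link_size_gt0 k.
pose D : set (set M) := [set W | [/\ open W, connected W & diam_le h W]].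
have [D' [finD' D'D KD']] : exists D', [/\ finite_set D', D' `<=` D &
    K `<=` \bigcup_(W in D') W].
  apply: (compact_finite_subcover cK) => [W []//|x Kx].
  by have [W [oW Wx cW dW]] := small_connected_nbhs x lcM h0; exists W.
pose tails E : set (set M) := [set C | [/\ connected C, C `<=` chain_limit &
  exists2 z, C z /\ E z & forall x, C x -> mdist z x <= 2 * h]].
pose blob E := \bigcup_(C in tails E) (E `|` C).
pose F : set (set M) := [set E | D' E /\ E `&` chain_hull k !=set0].
have FP E : F E -> [/\ connected E, diam_le h E & E `<=` chain_limit].
  move=> [/D'D[_ cE dE] mE]; split => // y Ey.
  by exists k.+1 => //; exists E.
exists (blob @` F); split.
- by apply: finite_image; apply: sub_finite_set finD' => E [].
- move=> _ [E FE <-]; have [cE dE ES] := FP E FE; split.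
  + have [z [Ez kz]] := FE.2; apply: bigcup_connected.
      by exists z => C _; left.
    by move=> C [cC _ [w [Cw Ew] _]]; apply: connectedU => //; exists w.
  + have center y : blob E y -> exists2 z, E z & mdist z y <= 2 * h.
      move=> [C [_ _ [z [Cz Ez] zC]] [Ey|Cy]].
        2: by exists z => //; exact: zC.
      by exists y => //; rewrite mdistxx mulr_ge0// ltW.
    move=> x y /center[x' Ex' xx'] /center[y' Ey' yy'].
    have := dE _ _ Ex' Ey'; have := metric_triangle x x' y.
    have := metric_triangle x' y' y; rewrite (metric_sym x x').
    move: xx' yy' kd; rewrite -/h; lra.
- rewrite bigcup_image; apply/seteqP; split => [y [n _ ny]|]; last first.
    apply: bigcup_sub => E FE; have [_ _ ES] := FP E FE.
    by apply: bigcup_sub => C [_ CS _]; rewrite subUset.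
  have /chain_hull_tail : chain_hull (k + n) y.
    by apply: chain_hull_sub ny; exact: leq_addl.
  move=> [C [z [cC Ck Cy [Cz kz] zC]]].
  have [E ED' Ez] : (\bigcup_(W in D') W) z by apply/KD'/SK; exists k.
  exists E; first by split => //; exists z.
  exists C; last by right.
  split => //; first by move=> x /Ck; exists (k + n)%N.
  exists z => // x /zC; have := link_size_gt0 (k + n); rewrite -/h; lra.
Qed.

End peano_neighbourhoods.

(** The closure of [chain_limit] inherits connectedness and property S; it is
    compact as soon as the ball of radius [2 * r] is inside a compact set. *)
Lemma peano_nbhs (R : realType) (M : metricType R) (p : M) (V : set M) :
  locally_compact [set: M] -> locally_connected [set: M] -> nbhs p V ->
  exists P, [/\ P `<=` V, nbhs p P, compact P, connected P & property_S P].
Proof.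
move=> lcpM lcM pV.
have [K [pK cK _]] := locally_compact_nbhs p lcpM.
have [e e0 eVK] := (iffLR (nbhs_mdistP _ _)) (filterI pV pK).
pose r := e / 4; have r0 : 0 < r by rewrite divr_gt0.
have clVK : closure (chain_limit p r) `<=` V `&` K.
  move=> y cy; apply: eVK.
  suff : mdist p y <= 2 * r by rewrite /r; move: e0; lra.
  apply: (@closed_mdist_le _ _ p (2 * r) y); apply: closureS cy => z.
  exact: chain_limit_bounded.
exists (closure (chain_limit p r)); split.
- by move=> y /clVK[].
- by apply: filterS (chain_limit_nbhs p r0 lcM); exact: subset_closure.
- apply: (subclosed_compact _ cK); first exact: closed_closure.
  by move=> y /clVK[].
- exact/connected_closure/chain_limit_connected.
- apply/property_S_closure/(chain_limit_property_S r0 lcM cK) => y Sy.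
  by have [] := clVK y (subset_closure Sy).
Qed.

(** * Counting the points of a continuum *)
Section ternary_expansion.
Context {R : realType}.
Implicit Types A B : set nat.

Definition ternary_digit A n : R := if n \in A then 3^-1 ^+ n else 0.

Definition ternary_partial A n : R := \sum_(0 <= i < n) ternary_digit A i.

Definition ternary_sum A : R := sup (range (ternary_partial A)).

Lemma ternary_partialS A n :
  ternary_partial A n.+1 = ternary_partial A n + ternary_digit A n.
Proof. by rewrite /ternary_partial big_nat_recr. Qed.

Lemma third_gt0 n : 0 < 3^-1 ^+ n :> R.
Proof. by rewrite exprn_gt0// invr_gt0. Qed.

Lemma ternary_partial_ndecr A m n :
  (m <= n)%N -> ternary_partial A m <= ternary_partial A n.
Proof.
move/subnKC <-; elim: (n - m)%N => [|k IH]; first by rewrite addn0.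
rewrite addnS ternary_partialS (le_trans IH)// lerDl /ternary_digit.
by case: ifP => // _; exact/ltW/third_gt0.
Qed.

Lemma ternary_partial_tail A m n :
  ternary_partial A m <= ternary_partial A n + 3 / 2 * 3^-1 ^+ n.
Proof.
have [mn|/ltnW/subnKC <-] := leqP m n.
  have := ternary_partial_ndecr A mn; have := third_gt0 n; lra.
suff : ternary_partial A (n + (m - n)) + 3 / 2 * 3^-1 ^+ (n + (m - n)) <=
    ternary_partial A n + 3 / 2 * 3^-1 ^+ n.
  have := third_gt0 (n + (m - n)); lra.
elim: (m - n)%N => [|k IH]; first by rewrite addn0.
rewrite addnS ternary_partialS exprS /ternary_digit.
have := third_gt0 (n + k); case: ifP => _; move: IH; lra.
Qed.

Lemma ternary_sum_ge A n : ternary_partial A n <= ternary_sum A.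
Proof.
apply: ub_le_sup; last by exists n.
by exists (ternary_partial A 0 + 3 / 2 * 3^-1 ^+ 0) => _ [m _ <-];
  exact: ternary_partial_tail.
Qed.

Lemma ternary_sum_le A n :
  ternary_sum A <= ternary_partial A n + 3 / 2 * 3^-1 ^+ n.
Proof.
apply: ge_sup; first by exists (ternary_partial A 0), 0%N.
by move=> _ [m _ <-]; exact: ternary_partial_tail.
Qed.

(** The weight of the first digit where [A] and [B] differ exceeds the sum of
    all later weights: [3^-n] against [3^-n / 2].  In base two the two would be
    equal and injectivity would fail. *)
Lemma ternary_sum_lt A B n : (forall m, (m < n)%N -> A m = B m) ->
  A n -> ~ B n -> ternary_sum B < ternary_sum A.
Proof.
move=> AB An Bn.
have := ternary_sum_ge A n.+1; have := ternary_sum_le B n.+1.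
have -> : ternary_partial A n.+1 = ternary_partial A n + 3^-1 ^+ n.
  by rewrite ternary_partialS /ternary_digit mem_set.
have -> : ternary_partial B n.+1 = ternary_partial B n.
  by rewrite ternary_partialS /ternary_digit memNset ?addr0.
rewrite exprS.
have -> : ternary_partial A n = ternary_partial B n.
  apply: eq_big_nat => m /andP[_ mn]; rewrite /ternary_digit.
  by congr (if _ then _ else _); apply/idP/idP => /set_mem;
    rewrite ?(AB m mn) => ?; apply/mem_set; rewrite ?(AB m mn).
have := third_gt0 n; lra.
Qed.

Lemma ternary_sum_inj : injective ternary_sum.
Proof.
move=> A B AB; apply/funext => n; elim/ltn_ind: n => n IH.
apply/propext; split => [An|Bn]; apply: contrapT => nn.
  by have := ternary_sum_lt IH An nn; rewrite AB ltxx.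
have /(_ _ _)/esym BA := IH.
by have := ternary_sum_lt BA Bn nn; rewrite AB ltxx.
Qed.

End ternary_expansion.

(** The pieces of the covers for [d = 1, 1/2, 1/3, ...] are countably many, and
    two distinct points never lie in the same pieces, so a point is determined
    by a set of natural numbers. *)
Lemma property_S_card_le (R : realType) (T : metricType R) (A : set T) :
  property_S A -> A #<= [set: R].
Proof.
move=> SA.
have /choice[F FP] (n : nat) : exists F : set (set T),
    [/\ finite_set F, forall E, F E -> connected E /\ diam_le n.+1%:R^-1 E &
        A = \bigcup_(E in F) E].
  by apply: SA; rewrite invr_gt0.
have /countable_injP[h hinj] : countable (\bigcup_n F n).
  apply: bigcup_countable => // n _; apply: finite_set_countable.
  by have [] := FP n.
pose code x := [set k | exists2 E, (\bigcup_n F n) E & h E = k /\ E x].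
suff code_inj : {in A &, injective code}.
  apply/pcard_injP; exists (ternary_sum \o code) => x y Ax Ay /ternary_sum_inj.
  exact: code_inj.
move=> x y /set_mem Ax /set_mem Ay xy; apply: contrapT => /eqP.
rewrite -mdist_gt0 => d0.
have [n nd] : exists n, n.+1%:R^-1 < mdist x y.
  have [n _ nP] := near_infty_natSinv_lt (PosNum d0).
  by exists n; exact: (nP n (leqnn n)).
have [_ FE AE] := FP n.
move: Ax; rewrite AE => -[E FnE Ex].
have : code x (h E) by exists E => //; exists n.
rewrite xy => -[E' UE' [hE E'y]].
have EE' : E' = E by apply: hinj => //; apply/mem_set => //; exists n.
have [_ /(_ x y Ex)] := FE E FnE; rewrite -EE' => /(_ E'y).
by rewrite leNgt nd.
Qed.

(** By connectedness the distance from [x] takes on [A] every value between [0]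
    and [mdist x y]. *)
Lemma connected_card_ge (R : realType) (T : metricType R) (A : set T) :
  connected A -> non_degenerate A -> [set: R] #<= A.
Proof.
move=> cA [x [y [Ax Ay /eqP]]]; rewrite -mdist_gt0 => d0.
have /connected_intervalP iA : connected (mdist x @` A).
  apply: connected_continuous_connected => //.
  apply: continuous_subspaceT => z; apply/cvgrPdist_lt => e e0.
  near=> z'; have : mdist z z' < e by near: z'; exact: nbhs_mdist_lt.
  apply: le_lt_trans; rewrite ler_norml.
  have := metric_triangle x z z'; have := metric_triangle x z' z.
  rewrite (metric_sym z' z); lra.
(* [t |-> expR (- expR t)] embeds the line into the unit interval. *)
have /choice[f fP] (t : R) :
    exists z, A z /\ mdist x z = mdist x y * expR (- expR t).
  suff [z Az zt] : (mdist x @` A) (mdist x y * expR (- expR t)) by exists z.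
  apply: (iA _ _ (ex_intro2 _ _ x Ax erefl) (ex_intro2 _ _ y Ay erefl)).
  rewrite mdistxx mulr_ge0 ?(ltW d0) ?expR_ge0//=.
  by rewrite ler_piMr ?(ltW d0)// -expR0 ler_expR oppr_le0 expR_ge0.
have /injfunPex[g] :
    exists2 f : R -> T, set_fun [set: R] A f & set_inj [set: R] f.
  exists f => [t _|s t _ _ fst]; first by have [] := fP t.
  have := (fP s).2; rewrite fst (fP t).2 => /(mulfI (lt0r_neq0 d0))/expR_inj.
  by move=> /oppr_inj/expR_inj.
exact: inj_card_le g.
Unshelve. all: by end_near. Qed.

(** * Orbit closures and minimal sets *)
Lemma compact_finite_bigcup (T : topologicalType) (F : set (set T)) :
  finite_set F -> (forall E, F E -> compact E) ->
  compact (\bigcup_(E in F) E).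
Proof.
move=> finF cF; rewrite -bigsetU_fset_set//; rewrite big_seq.
elim/big_ind : _ => [|A B|E]; [exact: compact0|exact: compactU|].
by rewrite in_fset_set// => /set_mem; exact: cF.
Qed.

Lemma locally_compact_set_nbhs (R : realType) (M : metricType R) (L V : set M) :
  locally_compact [set: M] -> compact L -> set_nbhs L V ->
  exists N, [/\ set_nbhs L N, compact (closure N) & closure N `<=` V].
Proof.
move=> lcpM cL LV.
pose D := [set W : set M | [/\ open W, compact (closure W) & closure W `<=` V]].
have [F [finF FD LF]] : exists F, [/\ finite_set F, F `<=` D &
    L `<=` \bigcup_(W in F) W].
  apply: (compact_finite_subcover cL) => [W []//|x Lx].
  have [K [pK cK _]] := locally_compact_nbhs x lcpM.
  have [e e0 eVK] := (iffLR (nbhs_mdistP _ _)) (filterI (LV x Lx) pK).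
  have e20 : 0 < e / 2 by rewrite divr_gt0.
  have ceVK : closure [set y | mdist x y < e / 2] `<=` V `&` K.
    move=> y cy; apply: eVK; apply: (@le_lt_trans _ _ (e / 2)); last lra.
    apply: (@closed_mdist_le _ _ x (e / 2) y); apply: closureS cy => z /=.
    exact: ltW.
  exists [set y | mdist x y < e / 2]; last by rewrite /= mdistxx.
  split.
  - rewrite openE => y /= xy; apply/nbhs_mdistP; exists (e / 2 - mdist x y).
      by rewrite subr_gt0.
    by move=> z yz /=; have := metric_triangle x y z; lra.
  - apply: (subclosed_compact _ cK); first exact: closed_closure.
    by move=> y /ceVK[].
  - by move=> y /ceVK[].
exists (\bigcup_(W in F) W).
have clF : closure (\bigcup_(W in F) W) `<=` \bigcup_(W in F) closure W.
  have : closed (\bigcup_(E in F) closure E).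
    by apply: closed_bigcup => // E _; exact: closed_closure.
  rewrite closure_id => ->; apply: closureS => x [E FE' Ex]; exists E => //.
  exact: subset_closure.
split.
- move=> x /LF xF; apply: open_nbhs_nbhs; split => //.
  by apply: bigcup_open => W /FD[].
- apply: (subclosed_compact _ _ clF); first exact: closed_closure.
  rewrite -[X in compact X](bigcup_image F closure id).
  apply: compact_finite_bigcup; first exact: finite_image.
  by move=> _ [W /FD[_ cW _] <-].
- by apply: (subset_trans clF); apply: bigcup_sub => W /FD[].
Qed.

Section flows.
Context {R : realType} {M : metricType R} (phi : R -> M -> M).
Hypothesis phi_flow : C0_flow phi.
Implicit Types (A B K V W : set M) (L G : compacts M).

Lemma flow0 x : phi 0 x = x.
Proof. by case: phi_flow. Qed.

Lemma flowD s t x : phi (s + t) x = phi s (phi t x).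
Proof. by case: phi_flow. Qed.

Lemma flowK t x : phi (- t) (phi t x) = x.
Proof. by rewrite -flowD addNr flow0. Qed.

Lemma flow_continuous t : continuous (phi t).
Proof.
case: phi_flow => cphi _ _ x.
apply: (@cvg_comp _ _ _ (fun y => (t, y)) (fun p => phi p.1 p.2)
  (nbhs x) (nbhs (t, x))); last exact: (cphi (t, x)).
move=> V [[A B] /= [tA xB] ABV]; apply: filterS xB => y By; apply: ABV.
by split => //; exact: nbhs_singleton.
Qed.

Lemma flow_time_continuous x : continuous (phi^~ x).
Proof.
case: phi_flow => cphi _ _ t.
apply: (@cvg_comp _ _ _ (fun s => (s, x)) (fun p => phi p.1 p.2)
  (nbhs t) (nbhs (t, x))); last exact: (cphi (t, x)).
move=> V [[A B] /= [tA xB] ABV]; apply: filterS tA => s As; apply: ABV.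
by split => //; exact: nbhs_singleton.
Qed.

Lemma flow_sub_closure t A :
  phi t @` A `<=` A -> phi t @` closure A `<=` closure A.
Proof.
move=> tA _ [x cx <-] V /(@flow_continuous t x)/cx[y [Ay Vy]].
by exists (phi t y); split => //; apply: tA; exists y.
Qed.

Lemma invariantI A B :
  flow_invariant phi A -> flow_invariant phi B -> flow_invariant phi (A `&` B).
Proof.
by move=> iA iB t _ [x [Ax Bx] <-]; split; [apply: iA|apply: iB]; exists x.
Qed.

Lemma invariant_flow A t x : flow_invariant phi A -> A x -> A (phi t x).
Proof. by move=> iA Ax; apply: iA; exists x. Qed.

Lemma invariant_flow_rev A t x : flow_invariant phi A -> A (phi t x) -> A x.
Proof. by move=> iA /(invariant_flow (- t) iA); rewrite flowK. Qed.

Definition orbit_closure x : set M := closure (range (phi^~ x)).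

Lemma orbit_closure_refl x : orbit_closure x x.
Proof. by apply: subset_closure; exists 0 => //; rewrite flow0. Qed.

Lemma orbit_closure_invariant x : flow_invariant phi (orbit_closure x).
Proof.
move=> t; apply: flow_sub_closure => _ [_ [s _ <-] <-].
by exists (t + s) => //; rewrite flowD.
Qed.

Lemma orbit_closure_sub A x : closed A -> flow_invariant phi A -> A x ->
  orbit_closure x `<=` A.
Proof.
move=> clA iA Ax; rewrite [A](iffLR (closure_id A) clA); apply: closureS.
by move=> _ [t _ <-]; exact: invariant_flow.
Qed.

Lemma orbit_closure_connected x : connected (orbit_closure x).
Proof.
apply/connected_closure/connected_continuous_connected.
  by apply/connected_intervalP => s t _ _ u.
exact/continuous_subspaceT/flow_time_continuous.
Qed.

Lemma minimal_sub A B x : minimal_set phi A -> closed B ->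
  flow_invariant phi B -> A x -> B x -> A `<=` B.
Proof.
move=> [A0 clA iA minA] clB iB Ax Bx.
suff <- : A `&` B = A by move=> y [].
apply: minA; [by exists x|exact: closedI|exact: invariantI|by move=> y []].
Qed.

Lemma minimal_orbit_closure A x : minimal_set phi A -> A x ->
  A = orbit_closure x.
Proof.
move=> mA Ax; have [_ clA iA _] := mA; apply/seteqP; split.
  apply: (minimal_sub mA _ _ Ax); [exact: closed_closure|
    exact: orbit_closure_invariant|exact: orbit_closure_refl].
exact: orbit_closure_sub.
Qed.

Lemma CMin_unique L G x :
  CMin phi L -> CMin phi G -> (L : set M) x -> (G : set M) x -> L = G.
Proof.
move=> mL mG Lx Gx; apply: compacts_inj.
by rewrite (minimal_orbit_closure mL Lx) (minimal_orbit_closure mG Gx).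
Qed.

(** Zorn's lemma, applied to the open complements [C] of the closed invariant
    sets that meet [K], ordered by inclusion.  Compactness of [K] makes unions
    of chains admissible. *)
Lemma exists_CMin_sub K : compact K -> K !=set0 -> flow_invariant phi K ->
  exists2 L, CMin phi L & (L : set M) `<=` K.
Proof.
move=> cK K0 iK; have clK := compact_closed (@metric_hausdorff _ M) cK.
pose P := [set C : set M |
  [/\ open C, flow_invariant phi (~` C) & (K `\` C) !=set0]].
have [|C [[oC iC KC] Cmax]] := @Zorn_bigcup _ P.
  move=> F FP totF; split.
  - by apply: bigcup_open => C /FP[].
  - move=> t _ [x Fx <-] [C FC Cx]; have [_ iC _] := FP C FC.
    by apply: Fx; exists C => //; apply: contrapT => /(invariant_flow t iC).
  have [[C0 FC0]|F0] := pselect (exists C, F C); last first.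
    have [x Kx] := K0; exists x; split => // -[C FC _].
    by apply: F0; exists C.
  pose G := filter_from F (fun C => K `\` C).
  have PG : ProperFilter G.
    apply: filter_from_proper; last by move=> C /FP[].
    apply: filter_from_filter; first by exists C0.
    move=> C1 C2 FC1 FC2; have [C12|C21] := totF _ _ FC1 FC2.
      by exists C2 => // x [Kx C2x]; split; split => // /C12.
    by exists C1 => // x [Kx C1x]; split; split => // /C21.
  have [|x [Kx Gx]] := cK G PG; first by exists C0 => // y [].
  exists x; split => // -[C FC Cx]; have [oC _ _] := FP C FC.
  have [|y [[_ nCy] Cy]] := Gx (K `\` C) C _ (open_nbhs_nbhs (conj oC Cx)).
    by exists C.
  exact: nCy.
have clL : closed (K `\` C) by apply: closedI => //; exact: open_closedC.
have cL : compact (K `\` C) by apply: (subclosed_compact _ cK) => // x [].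
exists (Compacts KC cL) => /=; last by move=> x [].
split => //; first exact: invariantI.
move=> B [b Bb] clB iB BKC; apply/seteqP; split => // x [Kx nCx].
apply: contrapT => nBx; apply: (Cmax (~` B)).
  split; first by move=> y Cy By; have [] := BKC y By.
  by move=> /(_ x nBx).
split; first exact: closed_openC.
  by rewrite setCK.
by exists b; split; [have [] := BKC b Bb|exact].
Qed.

(** One half of the Hausdorff distance is small as soon as [G] is close to
    [L].  For the other half, the orbit of each [x] in [L] is dense in [L]; by
    compactness and continuity, orbits of points near [L] still come within
    [e] of every point of [L], so an invariant [G] near [L] does too. *)
Lemma minimal_hausdorff_close L e : CMin phi L -> 0 < e ->
  exists2 N, set_nbhs (L : set M) N & forall G,
    (G : set M) `<=` N -> flow_invariant phi G -> mdist L G <= e.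
Proof.
move=> mL e0.
have [L0 cL] : (L : set M) !=set0 /\ compact (L : set M) by case: L {mL}.
have e30 : 0 < e / 3 by rewrite divr_gt0.
pose N1 := [set x | exists2 y, (L : set M) y & mdist x y < e].
pose N2 := [set x | (L : set M) `<=` fun y => exists t, mdist (phi t x) y < e].
exists (N1 `&` N2).
  move=> x Lx; apply: filterI.
    apply/nbhs_mdistP; exists e => // y xy; exists x => //.
    by rewrite metric_sym.
  move/compact_near_coveringP: cL; apply => y Ly.
  have : orbit_closure x y by rewrite -(minimal_orbit_closure mL Lx).
  move=> /(_ _ (nbhs_mdist_lt y e30))[_ [[t _ <-] /= yt]].
  near=> y' x'; exists t.
  have xx' : mdist (phi t x) (phi t x') < e / 3.
    by near: x'; exact: (@flow_continuous t x _ (nbhs_mdist_lt _ e30)).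
  have yy' : mdist y y' < e / 3 by near: y'; exact: nbhs_mdist_lt.
  move: xx' yy' yt; have := metric_triangle (phi t x') (phi t x) y'.
  have := metric_triangle (phi t x) y y'.
  rewrite (metric_sym (phi t x) y) (metric_sym (phi t x) (phi t x')); lra.
move=> G GN iG; have G0 : (G : set M) !=set0 by case: G {GN iG}.
change (hausdorff_dist L G <= e); rewrite ge_max; apply/andP; split.
  apply: hausdorff_excess_le => // y Ly; have [g Gg] := G0.
  have [t ty] := (GN g Gg).2 y Ly.
  apply: le_trans (dist_to_set_le y (invariant_flow t iG Gg)) _.
  by rewrite metric_sym ltW.
apply: hausdorff_excess_le => // x /GN[[y Ly xy] _].
exact: le_trans (dist_to_set_le x Ly) (ltW xy).
Unshelve. all: by end_near. Qed.

(** * Stability in non-wandering flows *)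
Section non_wandering_flows.
Hypothesis lcpM : locally_compact [set: M].
Hypothesis phi_nw : non_wandering phi.

(** At negative times this is where recurrence enters: if [y = phi t x] were
    outside [W], a neighbourhood of [y] disjoint from [W] would be carried
    into [W] by [phi (- t)] and remain there, contradicting the non-wandering
    property at [y]. *)
Lemma positively_invariant_interior W t x : closed W ->
  positively_invariant phi W -> W° x -> W (phi t x).
Proof.
move=> clW pW Wx; have [t0|t0] := leP 0 t.
  by apply: (pW t t0); exists x => //; exact: interior_subset.
apply: contrapT => nWy; set y := phi t x in nWy.
have Nt0 : 0 < - t by rewrite oppr_gt0.
have yN : nbhs y (~` W `&` phi (- t) @^-1` W°).
  apply: filterI.
    by apply: open_nbhs_nbhs; split => //; exact: closed_openC.
  apply: (@flow_continuous (- t)); rewrite flowK; exact: nbhs_interior.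
have [s ts [_ [[z [_ zW] <-] [nW _]]]] := phi_nw yN Nt0.
apply: nW; rewrite -(subrK (- t) s) flowD.
apply: (pW (s - - t)); first by rewrite subr_ge0.
by exists (phi (- t) z) => //; exact: interior_subset.
Qed.

(** The saturation of the interior of a closed positively invariant
    neighbourhood does not leave that neighbourhood, so its closure is
    compact. *)
Lemma stable_invariant_nbhs (L : set M) V :
  compact L -> lyapunov_stable phi L -> set_nbhs L V ->
  exists K, [/\ compact K, flow_invariant phi K, set_nbhs L K & K `<=` V].
Proof.
move=> cL sL /(locally_compact_set_nbhs lcpM cL)[N [LN cN NV]].
have [W [LW pW WN]] := sL N LN.
have pcW : positively_invariant phi (closure W).
  by move=> t t0; apply: flow_sub_closure; exact: pW.
pose O := \bigcup_t (phi t @` (closure W)°).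
have OW : O `<=` closure W.
  move=> _ [t _ [x Wx <-]]; apply: positively_invariant_interior => //.
  exact: closed_closure.
have cOW : closure O `<=` closure W.
  rewrite [X in _ `<=` X](iffLR (closure_id _) (@closed_closure _ W)).
  exact: closureS.
exists (closure O); split.
- apply: (subclosed_compact _ cN); first exact: closed_closure.
  exact/(subset_trans cOW)/closureS.
- move=> t; apply: flow_sub_closure => _ [_ [s _ [x Wx <-]] <-].
  by exists (t + s) => //; exists x => //; rewrite flowD.
- move=> x /LW xW; have : nbhs x (closure W)°.
    apply: nbhs_interior; apply: filterS xW; exact: subset_closure.
  apply: filterS => y Wy; apply: subset_closure; exists 0 => //.
  by exists y => //; rewrite flow0.
- by apply: subset_trans NV; apply/(subset_trans cOW)/closureS.
Qed.

(** A minimal set that meets a closed invariant set is contained in it; hence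
    meeting a small invariant neighbourhood of [L] forces closeness to [L]. *)
Lemma stable_CMin_nbhs L e : CMin phi L -> lyapunov_stable phi L -> 0 < e ->
  exists2 K, set_nbhs (L : set M) K & forall G,
    CMin phi G -> K `&` G !=set0 -> mdist L G <= e.
Proof.
move=> mL sL e0; have cL : compact (L : set M) by case: L {mL sL}.
have [N LN NP] := minimal_hausdorff_close mL e0.
have [K [cK iK LK KN]] := stable_invariant_nbhs cL sL LN; exists K => //.
move=> G mG [x [Kx Gx]]; apply: NP; last by case: mG.
apply: subset_trans KN; apply: (minimal_sub mG _ iK Gx Kx).
exact: compact_closed (@metric_hausdorff _ M) cK.
Qed.

(** Stable minimal sets attract nothing from outside: an orbit accumulating on
    [L] enters every invariant neighbourhood of [L], hence lies in it, and
    these neighbourhoods shrink to [L]. *)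
Lemma orbit_closure_stable L x : CMin phi L -> lyapunov_stable phi L ->
  (L : set M) `<=` orbit_closure x -> (L : set M) x.
Proof.
move=> mL sL Lx; have cL : compact (L : set M) by case: L {mL sL Lx}.
apply: contrapT => nLx.
have Lnx : set_nbhs (L : set M) (~` [set x]).
  move=> y Ly; apply: open_nbhs_nbhs; split.
    exact/closed_openC/(compact_closed (@metric_hausdorff _ M))/compact_set1.
  by move=> yx; apply: nLx; rewrite -yx.
have [K [cK iK LK Kx]] := stable_invariant_nbhs cL sL Lnx.
have [[y Ly] _ _ _] := mL.
have [_ [[t _ <-] Kt]] := Lx y Ly K (LK y Ly).
exact: (Kx x (invariant_flow_rev iK Kt)).
Qed.

(** Unstable minimal sets at Hausdorff distance at least [e] from [L] cannot
    meet the neighbourhood of [L] given by [stable_CMin_nbhs]. *)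
Lemma hyper_stable_nbhs L : CMin phi L -> ~ closure (unstable_CMin phi) L ->
  exists B, [/\ open B, (L : set M) `<=` B &
    forall G, unstable_CMin phi G -> B `&` G = set0].
Proof.
move=> mL nL.
have sL : lyapunov_stable phi L.
  by apply: contrapT => nsL; apply: nL; exact: subset_closure.
have [Q [LQ QU]] : exists Q : set (compacts M),
    nbhs L Q /\ unstable_CMin phi `&` Q = set0.
  apply: contrapT => nQ; apply: nL => Q LQ; apply/set0P/eqP => UQ0.
  by apply: nQ; exists Q.
have [e e0 eQ] := (iffLR (nbhs_mdistP _ _)) LQ.
have e20 : 0 < e / 2 by rewrite divr_gt0.
have [K LK KP] := stable_CMin_nbhs mL sL e20.
move/set_nbhsP: LK => [B [oB LB BK]]; exists B; split => // G uG.
apply/eqP/negPn/negP => /set0P[x [Bx Gx]].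
have : (unstable_CMin phi `&` Q) G.
  split => //; apply: eQ; apply: (@le_lt_trans _ _ (e / 2)); last lra.
  by apply: KP; [case: uG|exists x; split => //; exact: BK].
by rewrite QU.
Qed.

End non_wandering_flows.
End flows.

(** * Partition of a stable region into minimal sets *)
Section stable_regions.
Context {R : realType} {M : metricType R} (phi : R -> M -> M).
Hypothesis phi_flow : C0_flow phi.
Hypothesis lcpM : locally_compact [set: M].
Hypothesis phi_nw : non_wandering phi.
Variables (W : set M) (L0 : compacts M).
Hypothesis W_compact : compact W.
Hypothesis W_invariant : flow_invariant phi W.
Hypothesis W_stable : forall G, unstable_CMin phi G -> W `&` G = set0.

Lemma stable_region_CMin x : W x ->
  exists L, [/\ CMin phi L, lyapunov_stable phi L, (L : set M) x &
    (L : set M) `<=` W].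
Proof.
move=> Wx; have clW := compact_closed (@metric_hausdorff _ M) W_compact.
have OW := orbit_closure_sub clW W_invariant Wx.
have [|||L mL LO] := @exists_CMin_sub _ _ phi (orbit_closure phi x).
- by apply: (subclosed_compact _ W_compact) => //; exact: closed_closure.
- by exists x; exact: orbit_closure_refl.
- exact: orbit_closure_invariant.
have LW := subset_trans LO OW.
have sL : lyapunov_stable phi L.
  apply: contrapT => nsL; have [[y Ly] _ _ _] := mL.
  have := W_stable (conj mL nsL); rewrite -subset0 => /(_ y); apply.
  by split => //; exact: LW.
exists L; split => //.
exact: (orbit_closure_stable phi_flow lcpM phi_nw mL sL LO).
Qed.

(** The quotient map of the partition of [W] into minimal sets; [L0] is a
    junk value for points that lie in no compact minimal set. *)
Definition CMin_at x : compacts M :=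
  xget L0 [set L | CMin phi L /\ (L : set M) x].

Lemma CMin_atP x : W x ->
  [/\ CMin phi (CMin_at x), lyapunov_stable phi (CMin_at x),
    (CMin_at x : set M) x & (CMin_at x : set M) `<=` W].
Proof.
move=> /stable_region_CMin[L [mL sL Lx LW]].
rewrite /CMin_at; case: xgetP => [G _ [mG Gx]|/(_ L)[]//].
by rewrite (CMin_unique phi_flow mG mL Gx Lx).
Qed.

Lemma CMin_at_eq L x : CMin phi L -> (L : set M) x -> CMin_at x = L.
Proof.
move=> mL Lx; rewrite /CMin_at; case: xgetP => [G _ [mG Gx]|/(_ L)[]//].
exact: CMin_unique mG mL Gx Lx.
Qed.

Lemma CMin_at_continuous : {within W, continuous CMin_at}.
Proof.
apply/within_continuous_mdistP => x Wx e e0.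
have [mL sL Lx _] := CMin_atP Wx.
have e20 : 0 < e / 2 by rewrite divr_gt0.
have [K LK KP] := stable_CMin_nbhs phi_flow lcpM phi_nw mL sL e20.
apply: filterS (LK x Lx) => y Ky Wy; have [mG _ Gy _] := CMin_atP Wy.
apply: (@le_lt_trans _ _ (e / 2)); last lra.
by apply: KP => //; exists y.
Qed.

(** The natural neighbourhoods of a minimal set: unlike an arbitrary invariant
    neighbourhood, the saturation of [P] has a space of minimal sets which is
    a continuous image of [P]. *)
Definition saturation (P : set M) : set M := star (CMin_at @` P).

Lemma saturationE P : P `<=` W ->
  saturation P = W `&` CMin_at @^-1` (CMin_at @` P).
Proof.
move=> PW; apply/seteqP; split => x.
  move=> [_ [p Pp <-] px]; have [mp _ _ pW] := CMin_atP (PW p Pp).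
  by split; [exact: pW|exists p; rewrite // (CMin_at_eq mp px)].
move=> [Wx [p Pp px]]; exists (CMin_at p); first by exists p.
by rewrite px; have [] := CMin_atP Wx.
Qed.

Lemma saturation_compact P : P `<=` W -> compact P -> compact (saturation P).
Proof.
move=> PW cP; have cPP : compact (CMin_at @` P).
  apply: continuous_compact cP.
  exact: continuous_subspaceW PW CMin_at_continuous.
have clPP := compact_closed (@metric_hausdorff _ _) cPP.
have clW := compact_closed (@metric_hausdorff _ M) W_compact.
apply: (subclosed_compact _ W_compact); rewrite saturationE//.
move=> x cx; have Wx : W x by apply: clW; apply: closureS cx => y [].
split => //; apply: clPP => V xV.
have [e e0 eV] := (iffLR (nbhs_mdistP _ _)) xV.
have := (iffLR (within_continuous_mdistP _ _)) CMin_at_continuous x Wx e e0.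
move=> /cx[y [[Wy Py] /(_ Wy)/eV Vy]].
by exists (CMin_at y).
Qed.

Lemma saturation_sub P : P `<=` W -> P `<=` saturation P.
Proof.
by move=> PW x Px; rewrite saturationE//; split; [exact: PW|exists x].
Qed.

Lemma saturation_invariant P : P `<=` W -> flow_invariant phi (saturation P).
Proof.
move=> PW t _ [x [_ [p Pp <-] px] <-]; exists (CMin_at p); first by exists p.
by have [[_ _ ip _] _ _ _] := CMin_atP (PW p Pp); apply: ip; exists x.
Qed.

(** Orbit closures are connected and all those involved meet [P]. *)
Lemma saturation_connected P : P `<=` W -> connected P ->
  connected (saturation P).
Proof.
move=> PW cP; have [->|/set0P[p0 Pp0]] := eqVneq P set0.
  by rewrite /saturation /star image_set0 bigcup_set0; exact: connected0.
have -> : saturation P = \bigcup_(p in P) (P `|` CMin_at p).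
  apply/seteqP; split => [x [_ [p Pp <-] px]|x].
    by exists p => //; right.
  move=> [p Pp [/(saturation_sub PW)//|px]].
  by exists (CMin_at p) => //; exists p.
apply: bigcup_connected; first by exists p0 => p _; left.
move=> p Pp; have [mp _ pp _] := CMin_atP (PW p Pp).
apply: connectedU => //; first by exists p.
rewrite (minimal_orbit_closure phi_flow mp pp).
exact: orbit_closure_connected.
Qed.

(** A neighbourhood [P] of a single point [p] of [L] is enough: the orbit of any
    [x] in [L] is dense in [L], so it visits the interior of [P], and [x]
    has a neighbourhood that does the same. *)
Lemma saturation_nbhs P L p : P `<=` W -> CMin phi L -> (L : set M) p ->
  nbhs p P -> set_nbhs (L : set M) (saturation P).
Proof.
move=> PW mL Lp pP x Lx.
have : orbit_closure phi x p by rewrite -(minimal_orbit_closure phi_flow mL Lx).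
move=> /(_ _ (nbhs_interior pP))[_ [[t _ <-] xtP]].
have : nbhs x (phi t @^-1` P).
  exact: (@flow_continuous _ _ _ phi_flow t x _ xtP).
apply: filterS => y Py.
apply: (invariant_flow_rev phi_flow (saturation_invariant PW) (t := t)).
exact: (saturation_sub PW).
Qed.

Lemma HS_saturation B P : open B -> W `<=` B ->
  (forall G, unstable_CMin phi G -> B `&` G = set0) -> P `<=` W ->
  HS phi (saturation P) = CMin_at @` P.
Proof.
move=> oB WB BG PW; apply/seteqP; split => L.
  move=> [[mL _] LP]; have [[x Lx] _ _ _] := mL.
  have [G [p Pp pG] Gx] := LP x Lx; exists p => //; rewrite pG.
  have [mp _ _ _] := CMin_atP (PW p Pp).
  by apply: CMin_unique mL Gx Lx => //; rewrite -pG.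
move=> [p Pp <-]; have [mp _ _ pW] := CMin_atP (PW p Pp); split.
  split => //; exists B => // x px; apply: open_nbhs_nbhs; split => //.
  exact/WB/pW.
by move=> x px; exists (CMin_at p) => //; exists p.
Qed.

End stable_regions.

(** * Neighbourhoods of a minimal set *)
Theorem theorem4 (R : realType) (M : metricType R) (phi : R -> M -> M)
    (Lambda : compacts M) :
  generalized_peano_continuum M ->
  C0_flow phi ->
  non_wandering phi ->
  CMin phi Lambda ->
  closure_CMin phi (unstable_CMin phi) Lambda \/
  [/\ (Lambda : set M) = [set: M], compact [set: M] & minimal_flow phi] \/
  (forall V : set M, set_nbhs (Lambda : set M) V ->
    exists U : set M,
      (U `<=` V /\ set_nbhs (Lambda : set M) U) /\
      [/\ compact U, connected U & flow_invariant phi U] /\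
      (U = star (HS phi U) /\ HS phi U #= [set: R]) /\
      (peano_continuum (HS phi U) /\ non_degenerate (HS phi U))).
Proof.
move=> [lcpM cM lcM] phi_flow phi_nw mL.
have [LU|nLU] := pselect (closure (unstable_CMin phi) Lambda); first by left.
right; have [[p Lp] clL iL _] := mL.
have cL : compact (Lambda : set M) by case: Lambda {mL nLU Lp clL iL}.
have [LT|LnT] := pselect ((Lambda : set M) = [set: M]).
  by left; split; rewrite -?LT//; rewrite /minimal_flow -LT.
right=> V LV.
have sL : lyapunov_stable phi Lambda.
  by apply: contrapT => nsL; apply: nLU; exact: subset_closure.
have [B [oB LB BG]] := hyper_stable_nbhs phi_flow lcpM phi_nw mL nLU.
have LVB : set_nbhs (Lambda : set M) (V `&` B).
  move=> x Lx; apply: filterI; first exact: LV.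
  by apply: open_nbhs_nbhs; split => //; exact: LB.
have [W [cW iW LW WVB]] := stable_invariant_nbhs phi_flow lcpM phi_nw cL sL LVB.
have WB : W `<=` B by move=> x /WVB[].
have WG G : unstable_CMin phi G -> W `&` G = set0.
  by move=> /BG; rewrite -!subset0; apply: subset_trans; exact: setSI.
have [P [PW pP cP conP SP]] := peano_nbhs lcpM lcM (LW p Lp).
pose pi := CMin_at phi Lambda.
have pi_cont : {within P, continuous pi}.
  apply: (continuous_subspaceW PW).
  exact: (@CMin_at_continuous _ _ _ phi_flow lcpM phi_nw _ _ cW iW WG).
pose U := saturation phi Lambda P.
have HSU : HS phi U = pi @` P.
  exact: (HS_saturation phi_flow lcpM phi_nw Lambda cW iW WG oB WB BG PW).
have LU : set_nbhs (Lambda : set M) U.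
  exact: (saturation_nbhs phi_flow lcpM phi_nw _ cW iW WG PW mL Lp pP).
have cU : compact U.
  exact: (@saturation_compact _ _ _ phi_flow lcpM phi_nw _ _ cW iW WG _ PW cP).
have US : U = star (HS phi U) by rewrite HSU.
have SpiP : property_S (pi @` P) by exact: property_S_image.
have cpiP : compact (pi @` P) by exact: continuous_compact.
have conpiP : connected (pi @` P) by exact: connected_continuous_connected.
have nd : non_degenerate (HS phi U).
  have LHS : HS phi U Lambda.
    rewrite HSU; exists p; first exact: nbhs_singleton.
    exact: CMin_at_eq.
  apply: contrapT => deg; apply: LnT.
  (* Otherwise [Lambda] is its own neighbourhood, hence clopen. *)
  have UL : U = Lambda.
    apply/seteqP; split; last by move=> x /LU/nbhs_singleton.
    rewrite US => x [L HSL Lx]; suff <- : L = Lambda by [].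
    by apply: contrapT => LL; apply: deg; exists L, Lambda.
  apply: cM; [by exists p| |by exists (Lambda : set M) => //; rewrite setTI].
  exists (Lambda : set M); last by rewrite setTI.
  by rewrite openE => x /LU; rewrite UL.
exists U; split; [split=> //|split; [split=> //|split; split=> //]].
- move=> x; rewrite US HSU => -[_ [q Pq <-] qx].
  have [_ _ _ qW] := CMin_atP phi_flow lcpM phi_nw Lambda cW iW WG (PW q Pq).
  by have [] := WVB x (qW x qx).
- exact: (@saturation_connected _ _ _ phi_flow lcpM phi_nw _ _ cW iW WG _
    PW conP).
- exact: (@saturation_invariant _ _ _ phi_flow lcpM phi_nw _ _ cW iW WG _ PW).
- rewrite HSU card_eq_le property_S_card_le//= connected_card_ge//.
  by rewrite -HSU.
- by rewrite /peano_continuum HSU; split => //;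
    exact: compact_property_S_locally_connected.
Qed.
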